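(* Let $\mathcal{A}$ be a finite alphabet and let $\alpha,\beta\in\mathcal{A}$ with $\alpha\neq\beta$. Each of the following equalities between (partially defined) maps on interval rearrangement ensemble schemes $\sigma:\bar{\mathcal{A}}\to\bar{\mathcal{A}}$ holds on the set of all those schemes for which its left-hand side is defined: $$(\Pi_{\alpha\beta}^{\mathrm{rb}})^{-1}=\mathcal{I}\circ\Pi_{\beta\alpha}^{\mathrm{rb}}\circ\mathcal{I}\quad\text{on }\{\sigma:\sigma(\beta\mathrm{e})=\alpha\mathrm{e}\},$$ $$(\Pi_{\alpha\beta}^{\mathrm{re}})^{-1}=\mathcal{I}\circ\Pi_{\alpha\beta}^{\mathrm{lb}}\circ\mathcal{I}\quad\text{on }\{\sigma:\sigma(\beta\mathrm{b})=\alpha\mathrm{b}\},$$ $$(\Pi_{\alpha\beta}^{\mathrm{lb}})^{-1}=\mathcal{I}\circ\Pi_{\alpha\beta}^{\mathrm{re}}\circ\mathcal{I}\quad\text{on }\{\sigma:\sigma(\alpha\mathrm{e})=\beta\mathrm{e}\},$$ $$(\Pi_{\alpha\beta}^{\mathrm{le}})^{-1}=\mathcal{I}\circ\Pi_{\beta\alpha}^{\mathrm{le}}\circ\mathcal{I}\quad\text{on }\{\sigma:\sigma(\alpha\mathrm{b})=\beta\mathrm{b}\}.$$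
   Context: Let $\mathcal{A}$ be a finite set (alphabet) with $d\ge1$ elements and $\bar{\mathcal{A}}=\mathcal{A}\times\{\mathrm{b},\mathrm{e}\}$ the doubled alphabet; its elements are written $\alpha\mathrm{b}=(\alpha,\mathrm{b})$ and $\alpha\mathrm{e}=(\alpha,\mathrm{e})$. An interval rearrangement ensemble (IRE) scheme is any permutation $\sigma$ of $\bar{\mathcal{A}}$. Duality: $\iota:\bar{\mathcal{A}}\to\bar{\mathcal{A}}$ swaps $\alpha\mathrm{b}$ with $\alpha\mathrm{e}$ for every $\alpha\in\mathcal{A}$, and $\mathcal{I}\sigma=\sigma\circ\iota$ for every scheme $\sigma$, i.e. $(\mathcal{I}\sigma)(\alpha\mathrm{b})=\sigma(\alpha\mathrm{e})$ and $(\mathcal{I}\sigma)(\alpha\mathrm{e})=\sigma(\alpha\mathrm{b})$. Elementary induction steps on schemes: for $\alpha\ne\beta$ in $\mathcal{A}$, the steps $\Pi_{\alpha\beta}^{\mathrm{rb}}$ and $\Pi_{\alpha\beta}^{\mathrm{re}}$ are defined for schemes with $\sigma(\alpha\mathrm{b})=\beta\mathrm{e}$, and the steps $\Pi_{\alpha\beta}^{\mathrm{lb}}$ and $\Pi_{\alpha\beta}^{\mathrm{le}}$ are defined for schemes with $\sigma(\beta\mathrm{e})=\alpha\mathrm{b}$. The image $\sigma'$ of $\sigma$ is given as follows. - $\Pi_{\alpha\beta}^{\mathrm{rb}}$: if $\sigma(\beta\mathrm{e})=\alpha\mathrm{e}$ then $\sigma'=\sigma$; otherwise $\sigma'(\alpha\mathrm{b})=\sigma(\beta\mathrm{e})$,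 $\sigma'(\beta\mathrm{e})=\alpha\mathrm{e}$, $\sigma'(\sigma^{-1}(\alpha\mathrm{e}))=\beta\mathrm{e}$, and $\sigma'=\sigma$ at all other elements. - $\Pi_{\alpha\beta}^{\mathrm{re}}$: if $\sigma(\beta\mathrm{b})=\alpha\mathrm{b}$ then $\sigma'=\sigma$; otherwise $\sigma'(\sigma^{-1}(\alpha\mathrm{b}))=\beta\mathrm{e}$, $\sigma'(\beta\mathrm{b})=\alpha\mathrm{b}$, $\sigma'(\alpha\mathrm{b})=\sigma(\beta\mathrm{b})$, and $\sigma'=\sigma$ at all other elements. - $\Pi_{\alpha\beta}^{\mathrm{lb}}$: if $\sigma(\alpha\mathrm{e})=\beta\mathrm{e}$ then $\sigma'=\sigma$; otherwise $\sigma'(\sigma^{-1}(\beta\mathrm{e}))=\alpha\mathrm{b}$, $\sigma'(\alpha\mathrm{e})=\beta\mathrm{e}$, $\sigma'(\beta\mathrm{e})=\sigma(\alpha\mathrm{e})$, and $\sigma'=\sigma$ at all other elements. - $\Pi_{\alpha\beta}^{\mathrm{le}}$: if $\sigma(\alpha\mathrm{b})=\beta\mathrm{b}$ then $\sigma'=\sigma$; otherwise $\sigma'(\beta\mathrm{e})=\sigma(\alpha\mathrm{b})$, $\sigma'(\alpha\mathrm{b})=\beta\mathrm{b}$, $\sigma'(\sigma^{-1}(\beta\mathrm{b}))=\alpha\mathrm{b}$, and $\sigma'=\sigma$ at all other elements. Each step is a bijection from its domain onto, respectively, $\{\sigma':\sigma'(\beta\mathrm{e})=\alpha\mathrm{e}\}$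 (rb), $\{\sigma':\sigma'(\beta\mathrm{b})=\alpha\mathrm{b}\}$ (re), $\{\sigma':\sigma'(\alpha\mathrm{e})=\beta\mathrm{e}\}$ (lb), $\{\sigma':\sigma'(\alpha\mathrm{b})=\beta\mathrm{b}\}$ (le); these sets are the domains of the inverse steps. *)

(* Defs.v *)
From mathcomp Require Import all_boot all_fingroup.

Set Implicit Arguments.
Unset Strict Implicit.
Unset Printing Implicit Defensive.

(* The doubled alphabet is A * bool: the second component is false for the
   mark "b" and true for the mark "e". *)
Notation doubled A := (A * bool)%type.
Notation scheme A := {perm doubled A}.

Definition bg (A : finType) (a : A) : doubled A := (a, false).
Definition en (A : finType) (a : A) : doubled A := (a, true).

Definition iota_dual (A : finType) (x : doubled A) : doubled A :=
  (x.1, ~~ x.2).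

Lemma iota_dual_inj (A : finType) : injective (@iota_dual A).
Proof. by move=> [a c] [b d] [-> /negb_inj ->]. Qed.

Definition dual (A : finType) (s : scheme A) : scheme A :=
  perm (inj_comp (@perm_inj _ s) (@iota_dual_inj A)).

(* Partial maps on schemes are functions to option.  In the steps below,
   insub turns a finite function into a permutation when it is injective;
   on the domain of the step it always is (step_rb_defined etc.), so None
   means exactly that the scheme is outside the domain.  Whenever the
   update is applied with a != b, the three updated points are pairwise
   distinct, so their order is immaterial. *)

Definition step_rb (A : finType) (a b : A) (s : scheme A) :
    option (scheme A) :=
  if s (bg a) != en b then None
  else if s (en b) == en a then Some s
  else insub [ffun x => [eta s with bg a |-> s (en b),
                                    en b |-> en a,
                                    (s^-1)%g (en a) |-> en b] x].

Definition step_re (A : finType) (a b : A) (s : scheme A) :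
    option (scheme A) :=
  if s (bg a) != en b then None
  else if s (bg b) == bg a then Some s
  else insub [ffun x => [eta s with (s^-1)%g (bg a) |-> en b,
                                    bg b |-> bg a,
                                    bg a |-> s (bg b)] x].

Definition step_lb (A : finType) (a b : A) (s : scheme A) :
    option (scheme A) :=
  if s (en b) != bg a then None
  else if s (en a) == en b then Some s
  else insub [ffun x => [eta s with (s^-1)%g (en b) |-> bg a,
                                    en a |-> en b,
                                    en b |-> s (en a)] x].

Definition step_le (A : finType) (a b : A) (s : scheme A) :
    option (scheme A) :=
  if s (en b) != bg a then None
  else if s (bg a) == bg b then Some s
  else insub [ffun x => [eta s with en b |-> s (bg a),
                                    bg a |-> bg b,
                                    (s^-1)%g (bg b) |-> bg a] x].

Lemma cycle3_inj (T : finType) (s : {perm T}) (x y : T) (v : T)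
    (f : {ffun T -> T}) :
  x != y -> s x != v -> s y != v ->
  f x = s y -> f y = v -> f ((s^-1)%g v) = s x ->
  (forall t, t != x -> t != y -> t != (s^-1)%g v -> f t = s t) ->
  injectiveb f.
Proof.
set z := (s^-1)%g v => xy sxv syv fx fy fz ft.
have sz : s z = v by rewrite permKV.
have zx : z != x by apply: contraNneq sxv => <-; rewrite sz.
have zy : z != y by apply: contraNneq syv => <-; rewrite sz.
pose g t := if t == x then y else if t == y then z else if t == z then x else t.
have fE t : f t = s (g t).
  rewrite /g; case: eqP => [->//|/eqP tx]; case: eqP => [->|/eqP ty].
    by rewrite sz.
  by case: eqP => [->//|/eqP tz]; apply: ft.
pose h t := if t == y then x else if t == z then y else if t == x then z else t.
have gK : cancel g h.
  move=> t; rewrite /g /h; have [->|tx] := eqVneq t x; first by rewrite eqxx.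
  have [->|ty] := eqVneq t y; first by rewrite (negPf zy) eqxx.
  have [->|tz] := eqVneq t z.
    by rewrite (negPf xy) [x == z]eq_sym (negPf zx) eqxx.
  by rewrite (negPf ty) (negPf tz) (negPf tx).
apply/injectiveP => t u; rewrite !fE => /perm_inj; exact: can_inj gK _ _.
Qed.

Lemma permV_neq (T : finType) (s : {perm T}) (x v : T) :
  s x != v -> ((s^-1)%g v == x) = false.
Proof.
by move=> sxv; apply/negbTE; apply: contraNneq sxv => <-;
  rewrite permKV.
Qed.

Lemma step_rb_defined (A : finType) (a b : A) (s : scheme A) :
  a != b -> isSome (step_rb a b s) = (s (bg a) == en b).
Proof.
move=> /negPf ab; rewrite /step_rb.
case: eqP => //= sx; case: eqP => //= /eqP sy.
have [xy yx] : (bg a != en b) /\ (en b == bg a) = false.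
  by rewrite /bg /en !xpair_eqE ?ab 1?[b == a]eq_sym ?ab ?andbF.
have sxv : s (bg a) != en a.
  by rewrite sx /bg /en xpair_eqE ?ab 1?[b == a]eq_sym ?ab ?andbF.
have zx := permV_neq sxv; have zy := permV_neq sy.
rewrite insubT //; apply: (cycle3_inj xy sxv sy); rewrite ?ffunE /=.
- by rewrite [_ == (s^-1)%g _]eq_sym ?zx ?(negPf xy) ?eqxx.
- by rewrite [_ == (s^-1)%g _]eq_sym ?zy ?yx ?eqxx.
- by rewrite ?zx ?zy ?eqxx ?sx.
by move=> t /negPf tx /negPf ty /negPf tz; rewrite ffunE /= ?tx ?ty ?tz.
Qed.

Lemma step_re_defined (A : finType) (a b : A) (s : scheme A) :
  a != b -> isSome (step_re a b s) = (s (bg a) == en b).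
Proof.
move=> /negPf ab; rewrite /step_re.
case: eqP => //= sx; case: eqP => //= /eqP sy.
have [xy yx] : (bg a != bg b) /\ (bg b == bg a) = false.
  by rewrite /bg /en !xpair_eqE ?ab 1?[b == a]eq_sym ?ab ?andbF.
have sxv : s (bg a) != bg a.
  by rewrite sx /bg /en xpair_eqE ?ab 1?[b == a]eq_sym ?ab ?andbF.
have zx := permV_neq sxv; have zy := permV_neq sy.
rewrite insubT //; apply: (cycle3_inj xy sxv sy); rewrite ?ffunE /=.
- by rewrite [_ == (s^-1)%g _]eq_sym ?zx ?(negPf xy) ?eqxx.
- by rewrite [_ == (s^-1)%g _]eq_sym ?zy ?yx ?eqxx.
- by rewrite ?zx ?zy ?eqxx ?sx.
by move=> t /negPf tx /negPf ty /negPf tz; rewrite ffunE /= ?tx ?ty ?tz.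
Qed.

Lemma step_lb_defined (A : finType) (a b : A) (s : scheme A) :
  a != b -> isSome (step_lb a b s) = (s (en b) == bg a).
Proof.
move=> /negPf ab; rewrite /step_lb.
case: eqP => //= sx; case: eqP => //= /eqP sy.
have [xy yx] : (en b != en a) /\ (en a == en b) = false.
  by rewrite /bg /en !xpair_eqE ?ab 1?[b == a]eq_sym ?ab ?andbF.
have sxv : s (en b) != en b.
  by rewrite sx /bg /en xpair_eqE ?ab 1?[b == a]eq_sym ?ab ?andbF.
have zx := permV_neq sxv; have zy := permV_neq sy.
rewrite insubT //; apply: (cycle3_inj xy sxv sy); rewrite ?ffunE /=.
- by rewrite [_ == (s^-1)%g _]eq_sym ?zx ?(negPf xy) ?eqxx.
- by rewrite [_ == (s^-1)%g _]eq_sym ?zy ?yx ?eqxx.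
- by rewrite ?zx ?zy ?eqxx ?sx.
by move=> t /negPf tx /negPf ty /negPf tz; rewrite ffunE /= ?tx ?ty ?tz.
Qed.

Lemma step_le_defined (A : finType) (a b : A) (s : scheme A) :
  a != b -> isSome (step_le a b s) = (s (en b) == bg a).
Proof.
move=> /negPf ab; rewrite /step_le.
case: eqP => //= sx; case: eqP => //= /eqP sy.
have [xy yx] : (en b != bg a) /\ (bg a == en b) = false.
  by rewrite /bg /en !xpair_eqE ?ab 1?[b == a]eq_sym ?ab ?andbF.
have sxv : s (en b) != bg b.
  by rewrite sx /bg /en xpair_eqE ?ab 1?[b == a]eq_sym ?ab ?andbF.
have zx := permV_neq sxv; have zy := permV_neq sy.
rewrite insubT //; apply: (cycle3_inj xy sxv sy); rewrite ?ffunE /=.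
- by rewrite [_ == (s^-1)%g _]eq_sym ?zx ?(negPf xy) ?eqxx.
- by rewrite [_ == (s^-1)%g _]eq_sym ?zy ?yx ?eqxx.
- by rewrite ?zx ?zy ?eqxx ?sx.
by move=> t /negPf tx /negPf ty /negPf tz; rewrite ffunE /= ?tx ?ty ?tz.
Qed.

(* The value at t is the unique scheme that f sends to t; None if there is no
   such scheme or more than one. *)
Definition pinverse (A : finType) (f : scheme A -> option (scheme A))
    (t : scheme A) : option (scheme A) :=
  [pick s | [forall r, (f r == Some t) == (r == s)]].

Definition dual_conj (A : finType) (f : scheme A -> option (scheme A))
    (s : scheme A) : option (scheme A) :=
  omap (@dual A) (f (dual s)).

Definition peq_on (A : finType) (D : {set scheme A})
    (f g : scheme A -> option (scheme A)) : Prop :=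
  forall s, s \in D -> exists2 t, f s = Some t & g s = Some t.

(* Main.v *)
Require Import Defs.
From mathcomp Require Import all_boot all_fingroup.

(** Each elementary step, including its degenerate case, is one and the same
    kind of map.  Let [x] be the argument and [w] the value in the condition
    [s x = w] defining the domain, and [y], [v] the argument and the value in
    the condition [s' y = v] defining the image.  Then the step is
      [s' = (w v) o s o (x y)],
    the composition of [s] with a transposition on each side: the 3-cycle of
    values in the generic case is the product of two transpositions, and these
    two cancel exactly when [s y = v] already holds, which is the case where
    the step fixes [s] ([step_rbE], [step_reE], [step_lbE], [step_leE]).

    The formula is an involution in [s] that exchanges the conditions [s x = w]
    and [s y = v], so inverting a step exchanges the pairs [(x, w)] and [(y, v)]
    ([pinverse_swap_step]).  Conjugating by duality composes [s] on the right
    with [iota], so it replaces [x], [y] by their duals and keeps [w], [v]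
    ([dual_conj_swap_step]).  The theorem then reduces to comparing, for each of
    the four steps, two quadruples [(x, w, y, v)] of elements of
    the doubled alphabet. *)

Set Implicit Arguments.
Unset Strict Implicit.
Unset Printing Implicit Defensive.

Local Open Scope group_scope.

(** Products of permutations act from left to right, so [tperm x y] acts on
    arguments and [tperm w v] on values. *)
Definition swap_step (T : finType) (x w y v : T) (s : {perm T}) :
    option {perm T} :=
  if s x == w then Some (tperm x y * s * tperm w v) else None.

(** The two transpositions cancel because [s] conjugates one into the other. *)
Lemma swap_id (T : finType) (x y : T) (s : {perm T}) :
  tperm x y * s * tperm (s x) (s y) = s.
Proof. by rewrite -tpermJ conjgE -mulgA mulKVg mulgA tperm2 mul1g. Qed.

(** The 3-cycle of values that defines a step in the generic case is the
    product of the two transpositions. *)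
Lemma insub_cycle3 (T : finType) (s : {perm T}) (x y v : T) (f : {ffun T -> T}) :
    x != y -> s x != v -> s y != v ->
    f =1 [eta s with x |-> s y, y |-> v, s^-1 v |-> s x] ->
  insub f = Some (tperm x y * s * tperm (s x) v) :> option {perm T}.
Proof.
move=> xy sxv syv fE.
suff -> : f = pval (tperm x y * s * tperm (s x) v) by exact: valK.
apply/ffunP => t; rewrite pvalE fE !permM /=.
have [->|tx] := eqVneq t x.
  by rewrite tpermL tpermD // 1?eq_sym // (inj_eq perm_inj) eq_sym.
have [->|ty] := eqVneq t y; first by rewrite tpermR tpermL.
rewrite [tperm x y t]tpermD 1?eq_sym //.
have [->|tz] := eqVneq t (s^-1 v); first by rewrite permKV tpermR.
rewrite tpermD //; first by rewrite (inj_eq perm_inj) eq_sym.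
by apply: contraNneq tz => ->; rewrite permK.
Qed.

(** The left-hand side is the shape shared by the four steps.  The assumption on
    [f] is restricted to the generic case, the only one in which the three
    updated arguments are distinct. *)
Lemma swap_stepE (T : finType) (x w y v : T) (s : {perm T}) (f : {ffun T -> T}) :
    x != y -> w != v ->
    (s x = w -> s y != v ->
       f =1 [eta s with x |-> s y, y |-> v, s^-1 v |-> w]) ->
  (if s x != w then None else if s y == v then Some s else insub f)
    = swap_step x w y v s.
Proof.
rewrite /swap_step => xy; have [<- /= sxv fE|//] := eqVneq (s x) w.
have [<-|syv] := eqVneq (s y) v; first by rewrite swap_id.
by apply: insub_cycle3 => //; apply: fE.
Qed.

(** The three updates have distinct arguments, so they can be listed in the
    opposite order. *)
Lemma cycle3_rev (T : finType) (s : {perm T}) (x y v : T) :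
    x != y -> s x != v -> s y != v ->
  [eta s with s^-1 v |-> s x, y |-> v, x |-> s y]
    =1 [eta s with x |-> s y, y |-> v, s^-1 v |-> s x].
Proof.
move=> /negPf xy sxv syv t /=.
have [->|tx] := eqVneq t x; first by rewrite eq_sym (permV_neq sxv) xy.
by have [->|//] := eqVneq t y; rewrite eq_sym (permV_neq syv).
Qed.

Lemma step_rbE (A : finType) (a b : A) : a != b ->
  step_rb a b =1 swap_step (bg a) (en b) (en b) (en a).
Proof.
move=> ab s; apply: swap_stepE => [||_ _ t]; last by rewrite ffunE.
  by rewrite xpair_eqE andbF.
by rewrite xpair_eqE andbT eq_sym.
Qed.

Lemma step_reE (A : finType) (a b : A) : a != b ->
  step_re a b =1 swap_step (bg a) (en b) (bg b) (bg a).
Proof.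
move=> ab; have xy : bg a != bg b by rewrite xpair_eqE andbT.
have wv : en b != bg a by rewrite xpair_eqE andbF.
move=> s; apply: swap_stepE => // sx sy t.
by rewrite ffunE -sx cycle3_rev // sx.
Qed.

Lemma step_lbE (A : finType) (a b : A) : a != b ->
  step_lb a b =1 swap_step (en b) (bg a) (en a) (en b).
Proof.
move=> ab; have xy : en b != en a by rewrite xpair_eqE andbT eq_sym.
have wv : bg a != en b by rewrite xpair_eqE andbF.
move=> s; apply: swap_stepE => // sx sy t.
by rewrite ffunE -sx cycle3_rev // sx.
Qed.

Lemma step_leE (A : finType) (a b : A) : a != b ->
  step_le a b =1 swap_step (en b) (bg a) (bg a) (bg b).
Proof.
move=> ab s; apply: swap_stepE => [||_ _ t]; last by rewrite ffunE.
  by rewrite xpair_eqE andbF.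
by rewrite xpair_eqE andbT.
Qed.

(** Transpositions are involutions, so the formula inverts itself; and if [r]
    sends [x] to [w] then its image sends [y] to [v], so the image lies in the
    domain of the step with the two pairs exchanged. *)
Lemma swap_stepK (T : finType) (x w y v : T) (r s : {perm T}) :
  (swap_step x w y v r == Some s) = (swap_step y v x w s == Some r).
Proof.
wlog suff : x w y v r s /
    swap_step x w y v r == Some s -> swap_step y v x w s == Some r.
  by move=> imp; apply/idP/idP; apply: imp.
rewrite /swap_step; case: (r x =P w) => [rx|//] /eqP [<-].
rewrite !permM tpermR rx tpermL eqxx.
by rewrite (tpermC y) (tpermC v) !mulgA tperm2 mul1g -mulgA tperm2 mulg1.
Qed.

Lemma pinverse_swap_step (A : finType) (f : scheme A -> option (scheme A))
    (x w y v : doubled A) :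
  f =1 swap_step x w y v -> pinverse f =1 swap_step y v x w.
Proof.
move=> fE t; rewrite /pinverse.
have inv s : [forall r, (f r == Some t) == (r == s)]
    = (swap_step y v x w t == Some s).
  apply/idP/eqP => [/forallP/(_ s)|ts].
    by rewrite eqxx eqb_id fE swap_stepK => /eqP.
  by apply/forallP => r; rewrite fE swap_stepK ts [Some s == _]eq_sym.
case: pickP => [s|no]; first by rewrite inv => /eqP.
by case E: (swap_step y v x w t) (no) => [s|//] /(_ s); rewrite inv E eqxx.
Qed.

Lemma iota_dualK (A : finType) : involutive (@iota_dual A).
Proof. by move=> [c m]; rewrite /iota_dual negbK. Qed.

Lemma dualE (A : finType) (s : scheme A) t : dual s t = s (iota_dual t).
Proof. by rewrite permE. Qed.

(** Duality acts on arguments only, and conjugating the transposition of [x] and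
    [y] by [iota_dual] gives the transposition of their duals. *)
Lemma dual_conj_swap_step (A : finType) (f : scheme A -> option (scheme A))
    (x w y v : doubled A) : f =1 swap_step x w y v ->
  dual_conj f =1 swap_step (iota_dual x) w (iota_dual y) v.
Proof.
move=> fE s; rewrite /dual_conj fE /swap_step dualE.
case: eqP => //= _; congr Some; apply/permP => t.
rewrite dualE !permM dualE (inj_tperm _ _ _ (@iota_dual_inj A)).
by rewrite iota_dualK.
Qed.

Lemma peq_on_swap_step (A : finType) (f g : scheme A -> option (scheme A))
    (x w y v : doubled A) : f =1 swap_step x w y v -> g =1 swap_step x w y v ->
  peq_on [set s : scheme A | s x == w] f g.
Proof.
move=> fE gE s; rewrite inE => sx; exists (tperm x y * s * tperm w v);
  by rewrite ?fE ?gE /swap_step sx.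
Qed.

Theorem theorem1 (A : finType) (a b : A) (hab : a <> b) :
  [/\ peq_on [set s : scheme A | s (en b) == en a]
        (pinverse (step_rb a b)) (dual_conj (step_rb b a)),
      peq_on [set s : scheme A | s (bg b) == bg a]
        (pinverse (step_re a b)) (dual_conj (step_lb a b)),
      peq_on [set s : scheme A | s (en a) == en b]
        (pinverse (step_lb a b)) (dual_conj (step_re a b))
    & peq_on [set s : scheme A | s (bg a) == bg b]
        (pinverse (step_le a b)) (dual_conj (step_le b a))].
Proof.
have ab : a != b by apply/eqP.
have ba : b != a by rewrite eq_sym.
split; apply: peq_on_swap_step.
- exact: pinverse_swap_step (step_rbE ab).
- exact: dual_conj_swap_step (step_rbE ba).
- exact: pinverse_swap_step (step_reE ab).
- exact: dual_conj_swap_step (step_lbE ab).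
- exact: pinverse_swap_step (step_lbE ab).
- exact: dual_conj_swap_step (step_reE ab).
- exact: pinverse_swap_step (step_leE ab).
- exact: dual_conj_swap_step (step_leE ba).
Qed.
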